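(* Let $X=\{0,1,\ldots,K\}$ and let $Y=\{\{0\},(0,1),\{1\},(1,2),\ldots,\{K-1\},(K-1,K),\{K\}\}$ (a finite set whose elements are these singletons and open intervals). For each $n$ let $f_n:X^n\to Y$ map $(x_1,\ldots,x_n)$ to the unique element of $Y$ containing the average $\frac1n\sum_{i=1}^n x_i$. Then the family $(f_n)$ is computable (with finite memory).
   Context: Model of computation. Let $X$ (initial values), $Y$ (outputs), $M$ (messages) be sets and, for each integer $d\ge 0$, let $Z_d$ be a set (memory states); each of $Y$, $M$, $Z_d$ contains a distinguished element $\emptyset$. An automaton family is a sequence of maps $(A_d)_{d\ge0}$, $A_d: X\times Z_d\times Y\times M^d\to X\times Z_d\times Y\times M^d$, which leave the first coordinate unchanged. A network is a finite connected simple undirected graph $G=(V,E)$ with $V=\{1,\ldots,n\}$, together with a port labeling: for each node $i$ of degree $d(i)$, a bijection $\ell_i$ from the set of neighbors of $i$ to $\{1,\ldots,d(i)\}$. Given initial values $x_1,\ldots,x_n\in X$, the execution is: node $i$ has state $S_i(t)=(x_i,z_i(t),y_i(t),m_{i,1}(t),\ldots,m_{i,d(i)}(t))$ with $z_i(0)=y_i(0)=m_{i,k}(0)=\emptyset$ ($m_{i,p}(t)$ is the message $i$ sends through its port $p$), and $S_i(t+1)=A_{d(i)}(x_i,z_i(t),y_i(t),\mu_{i,1}(t),\ldots,\mu_{i,d(i)}(t))$, where if $j$ is the neighbor of $i$ with $\ell_i(j)=k$ then $\mu_{i,k}(t)=m_{j,\ell_j(i)}(t)$. An element $y^*\in Y$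 is the final output of the execution if there is $t'$ with $y_i(t)=y^*$ for all nodes $i$ and all $t\ge t'$. Finite memory: $X,Y,M$ and all $Z_d$ are finite and $\log|Z_d|\le Cd$ for all $d\ge1$, for a constant $C$ independent of $d$. A family of functions $(f_n:X^n\to Y)_{n\ge1}$ is computable if there exists an automaton family with finite memory such that for every $n$, every network with $n$ nodes (every connected graph and every port labeling), and every $x\in X^n$, the execution has a final output equal to $f_n(x_1,\ldots,x_n)$. *)

(* Defs.v *)
From HB Require Import structures.
From mathcomp Require Import all_boot all_order all_algebra.
Set Implicit Arguments. Unset Strict Implicit. Unset Printing Implicit Defensive.
Import Order.TTheory GRing.Theory Num.Theory.
Local Open Scope ring_scope.

Definition deg (n : nat) (e : rel 'I_n) (i : 'I_n) : nat := #|[pred j | e i j]|.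

Definition simple_connected_graph (n : nat) (e : rel 'I_n) : Prop :=
  irreflexive e /\ symmetric e /\ (forall i j, connect e i j).

(* Port labeling, given through the inverse of the bijections l_i:
   nbr i k is the neighbor of i behind port k (ports 0-based: 'I_(deg i)).
   nbr i must be a bijection from 'I_(deg i) onto the neighbors of i. *)
Definition port_labeling (n : nat) (e : rel 'I_n)
  (nbr : forall i : 'I_n, 'I_(deg e i) -> 'I_n) : Prop :=
  forall i, injective (nbr i) /\ (forall k, e i (nbr i k)) /\
            (forall j, e i j -> exists k, nbr i k = j).

(* state of a node of degree d (the constant initial value x_i is kept apart):
   memory, output (None = the distinguished empty output), messages per port *)
Definition state (Z : nat -> finType) (Y M : Type) (d : nat) : Type :=
  (Z d * option Y * {ffun 'I_d -> M})%type.

(* automaton family: A_d maps (x, z, y, received messages) to (z', y', sent messages);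
   the first coordinate x is left unchanged, so it is not part of the output *)
Definition automaton (X Y M : Type) (Z : nat -> finType) : Type :=
  forall d : nat, X -> Z d -> option Y -> {ffun 'I_d -> M} -> state Z Y M d.

Section Exec.
Local Unset Implicit Arguments.
Variables (X Y : Type) (M : finType) (Z : nat -> finType).
Variables (z0 : forall d, Z d) (m0 : M) (A : automaton X Y M Z).
Variables (n : nat) (e : rel 'I_n) (nbr : forall i : 'I_n, 'I_(deg e i) -> 'I_n).
Variable (x : 'I_n -> X).

Definition received (s : forall j : 'I_n, state Z Y M (deg e j)) (i : 'I_n)
  : {ffun 'I_(deg e i) -> M} :=
  [ffun k : 'I_(deg e i) =>
     let j := nbr i k in
     match [pick p : 'I_(deg e j) | nbr j p == i] return M with
     | Some p => (s j).2 p
     | None => m0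
     end].

Fixpoint exec (t : nat) : forall i : 'I_n, state Z Y M (deg e i) :=
  match t with
  | 0 => fun i => (z0 (deg e i), None, [ffun => m0])
  | t'.+1 => fun i =>
      let s := exec t' in
      A (deg e i) (x i) (s i).1.1 (s i).1.2 (received s i)
  end.

Definition output (t : nat) (i : 'I_n) : option Y := (exec t i).1.2.
End Exec.
Arguments exec {X Y M Z} z0 m0 A {n e} nbr x t.
Arguments received {Y M Z} m0 {n e} nbr s i.
Arguments output {X Y M Z} z0 m0 A {n e} nbr x t i.

(* finite memory: log |Z_d| <= C d for d >= 1 (log base 2; C may be taken natural) *)
Definition finite_memory (Z : nat -> finType) : Prop :=
  exists C : nat, forall d : nat, (1 <= d)%N -> (#|Z d| <= 2 ^ (C * d))%N.

Definition computable (X Y : finType) (f : forall n : nat, ('I_n -> X) -> Y) : Prop :=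
  exists (M : finType) (Z : nat -> finType) (z0 : forall d, Z d) (m0 : M)
         (A : automaton X Y M Z),
    finite_memory Z /\
    forall (n : nat), (0 < n)%N ->
    forall (e : rel 'I_n) (nbr : forall i : 'I_n, 'I_(deg e i) -> 'I_n),
      simple_connected_graph e -> port_labeling nbr ->
      forall x : 'I_n -> X,
        exists t', forall t, (t' <= t)%N -> forall i,
          output z0 m0 A nbr x t i = Some (f n x).

(* Y = {{0},(0,1),{1},...,(K-1,K),{K}} encoded by 'I_(2K+1):
   index 2k is the singleton {k}, index 2k+1 is the open interval (k,k+1). *)
Definition inY (K : nat) (y : 'I_(K.*2.+1)) (a : rat) : bool :=
  if odd y then (((y./2)%:R < a) && (a < (y./2).+1%:R))%R
  else a == (y./2)%:R.

Definition average (K n : nat) (x : 'I_n -> 'I_K.+1) : rat :=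
  ((\sum_(i < n) ((x i : nat)%:R : rat)) / n%:R)%R.

Definition f_avg (K : nat) (n : nat) (x : 'I_n -> 'I_K.+1) : 'I_(K.*2.+1) :=
  odflt ord0 [pick y : 'I_(K.*2.+1) | inY y (average x)].

(* Main.v *)
(** The average is below [k] iff the tokens, [x i] of them at node [i], do not fill all the
    holes, [k] of them at each node; it is above [k] iff [k] tokens per node do not fill
    [x i] holes at each node [i]. All these instances run in parallel.

    Tokens walk: each arriving token fills a local hole if there is one, and all others are
    sent on at once, a rotor at each node distributing them over the ports in cyclic order.
    If some node emits infinitely many tokens then so do its neighbors, hence all nodes, and
    every hole gets filled; otherwise no token moves after some time. Either way the set of
    nodes with holes becomes constant, and it is nonempty iff there are fewer tokens than holes.

    It remains to let every node know whether a node with a hole (a root) exists. Unlinked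
    nodes link to a neighbor that has been linked for at least one step, and a link is dropped
    one step after the parent dropped its own. Thus trees that lost their root grow at most at
    half the speed at which they collapse, and cannot survive for long. *)
Require Import Defs.
From mathcomp Require Import all_boot all_order all_algebra.
From mathcomp Require Import zify.
From Stdlib Require Import Classical.
Set Implicit Arguments. Unset Strict Implicit. Unset Printing Implicit Defensive.
Import Order.TTheory GRing.Theory Num.Theory.

(** * Arithmetic of the rotor *)

Lemma sum_divn_shift (d N : nat) : 0 < d -> \sum_(p < d) (N + p) %/ d = N.
Proof.
case: d => // d _; elim: N => [|N IH].
  by rewrite big1 // => p _; rewrite add0n divn_small.
(* Incrementing [N] shifts the window of summands by one; the new last one exceeds the dropped first
   one by 1. *)
rewrite big_ord_recr /= -[in RHS]IH big_ord_recl /= addn0.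
rewrite addSnnS divnDr ?dvdnn // divnn /= addn1 addnS addnC.
by congr (_ + _).+1; apply: eq_bigr => p _; rewrite addSnnS.
Qed.

Lemma sum_ltnS (F : nat -> nat) t : \sum_(s < t.+1) F s = \sum_(s < t) F s + F t.
Proof. by rewrite big_ord_recr. Qed.

Lemma sumD n (F G : 'I_n -> nat) : \sum_i (F i + G i) = \sum_i F i + \sum_i G i.
Proof. exact: big_split. Qed.

(** Counts the multiples of [d] from [r + p + 1] to [r + c + p]: after [r] earlier tokens, port [p]
    gets every [d]-th of the next [c]. *)
Definition share (d r c p : nat) : nat := (r + c + p) %/ d - (r + p) %/ d.

(** Lets a node store its rotor modulo [d] while the analysis counts all tokens emitted so far. *)
Lemma share_mod (d r c p : nat) : 0 < d -> share d (r %% d) c p = share d r c p.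
Proof.
move=> d0; rewrite /share {3 4}(divn_eq r d) -!addnA !divnMDl //.
by rewrite subnDl.
Qed.

Lemma share_le (d r c p B : nat) : 0 < d -> c <= d * B -> share d r c p <= B.
Proof.
move=> d0 cB; rewrite /share leq_subLR [leqRHS]addnC -(divnMDl B _ d0).
by apply: leq_div2r; nia.
Qed.

(** * The rotor walk of tokens into holes *)

Section RotorRouter.
(* At time [t], [hol t i] holes are unfilled, [c t i] tokens leave node [i], and [R t i] tokens
   have left it before; [port j i] is the port of [j] leading to [i]. *)
Variables (n : nat) (e : rel 'I_n) (port : 'I_n -> 'I_n -> nat).
Variables (h u : 'I_n -> nat) (hol c R inflow : nat -> 'I_n -> nat).
Hypothesis e_sym : symmetric e.
Hypothesis e_conn : forall i j, connect e i j.
Hypothesis port_sum : forall j (F : nat -> nat),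
  \sum_(i | e j i) F (port j i) = \sum_(p < deg e j) F p.
Hypothesis hol0 : forall i, hol 0 i = h i - u i.
Hypothesis c0 : forall i, c 0 i = u i - h i.
Hypothesis holS : forall t i, hol t.+1 i = hol t i - inflow t i.
Hypothesis cS : forall t i, c t.+1 i = inflow t i - hol t i.
Hypothesis R0 : forall i, R 0 i = 0.
Hypothesis RS : forall t i, R t.+1 i = R t i + c t i.
Hypothesis inflowE : forall t i, inflow t i =
  \sum_(j | e i j) share (deg e j) (R t j) (c t j) (port j i).

Lemma hol_mono s t i : s <= t -> hol t i <= hol s i.
Proof. by move/subnK <-; elim: (t - s) => // m IH; rewrite addSn holS; lia. Qed.

Lemma R_gt0_hol0 t i : 0 < R t.+1 i -> hol t i = 0.
Proof.
elim: t => [|t IH]; rewrite RS; first by rewrite R0 c0 hol0; lia.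
by case: (posnP (R t.+1 i)) => [->|/IH]; rewrite ?cS holS; lia.
Qed.

Lemma emitted_flow t i :
  R t.+1 i + h i = u i + \sum_(s < t) inflow s i + hol t i.
Proof.
elim: t => [|t IH]; first by rewrite big_ord0 RS R0 c0 hol0; lia.
by rewrite (sum_ltnS (inflow^~ i)) RS cS holS; lia.
Qed.

(** The shares telescope, so [i] receives at least [R t j %/ deg e j] tokens from [j], and at most
    [h i] tokens stay in its holes. *)
Lemma emitted_neighbor t i j : e i j -> R t j %/ deg e j <= R t.+1 i + h i.
Proof.
move=> eij; rewrite emitted_flow.
suff: (R t j + port j i) %/ deg e j <= port j i %/ deg e j + \sum_(s < t) inflow s i.
  have := leq_divDl (deg e j) (R t j) (port j i).
  case: (posnP (deg e j)) => [->|d0]; first by rewrite !divn0.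
  by rewrite divnD //; lia.
elim: t => [|t IH]; first by rewrite R0 add0n leq_addr.
have : share (deg e j) (R t j) (c t j) (port j i) <= inflow t i.
  by rewrite inflowE (bigD1 j) //= leq_addr.
by rewrite (sum_ltnS (inflow^~ i)) /share RS; lia.
Qed.

Definition unbounded i := forall B, exists t, B <= R t i.

Lemma unbounded_neighbor i j : e i j -> unbounded j -> unbounded i.
Proof.
move=> eij Uj B; have [t Ht] := Uj (deg e j * (B + h i)).
exists t.+1; have := emitted_neighbor t eij.
have d0 : 0 < deg e j by apply/card_gt0P; exists i; rewrite inE e_sym.
by have := leq_div2r (deg e j) Ht; rewrite mulKn //; lia.
Qed.

Lemma unbounded_all i j : unbounded j -> unbounded i.
Proof.
move=> Uj; have /connectP[p + ->] := e_conn j i.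
elim: p j Uj => //= k p IH j Uj /andP[ejk pk].
by apply: IH pk; apply: unbounded_neighbor Uj; rewrite e_sym.
Qed.

Lemma holes_filled i : unbounded i -> exists T, forall j t, T <= t -> hol t j = 0.
Proof.
move=> Ui; have /fin_all_exists[T HT] : forall j, exists T, hol T j = 0.
  move=> j; have [[|t]] := unbounded_all j Ui 1; first by rewrite R0.
  by exists t; apply: R_gt0_hol0.
exists (\max_j T j) => j t jt; apply/eqP; rewrite -leqn0 -(HT j); apply: hol_mono.
by apply: leq_trans jt; apply: leq_bigmax.
Qed.

Lemma some_unbounded : (forall t, 0 < \sum_i c t i) -> exists i, unbounded i.
Proof.
move=> C; apply: NNPP => nU.
have /fin_all_exists[B HB] : forall i, exists B, forall t, R t i <= B.
  move=> i; apply: NNPP => nB; apply: nU; exists i => B; apply: NNPP => nt.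
  apply: nB; exists B => t; case: (leqP (R t i) B) => // lt.
  by case: nt; exists t; apply: ltnW.
have low t : t <= \sum_i R t i.
  elim: t => // t IH; under eq_bigr do rewrite RS.
  by rewrite sumD; have := C t; lia.
have := low (\sum_i B i).+1; rewrite ltnNge; apply/negP; rewrite negbK.
by apply: leq_sum => i _.
Qed.

Section PositiveDegrees.
Hypothesis deg_gt0 : forall i, 0 < deg e i.

(** By [sum_divn_shift], the shares over all ports of [j] add up to [(R t j + c t j) - R t j]. A
    node of degree 0 would lose its surplus. *)
Lemma inflow_total t : \sum_i inflow t i = \sum_i c t i.
Proof.
under eq_bigr do rewrite inflowE.
rewrite (exchange_big_dep xpredT) //=; apply: eq_bigr => j _.
under eq_bigl do rewrite e_sym.
rewrite (port_sum j (share (deg e j) (R t j) (c t j))) sumnB; last first.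
  by move=> p _; apply: leq_div2r; lia.
by rewrite !sum_divn_shift //; lia.
Qed.

Lemma balance t : \sum_i c t i + \sum_i h i = \sum_i hol t i + \sum_i u i.
Proof.
elim: t => [|t IH].
  by rewrite -!sumD; apply: eq_bigr => i _ /=; rewrite c0 hol0; lia.
have : \sum_i c t.+1 i + \sum_i hol t i = \sum_i hol t.+1 i + \sum_i inflow t i.
  by rewrite -!sumD; apply: eq_bigr => i _ /=; rewrite cS holS; lia.
by rewrite inflow_total; lia.
Qed.

Lemma settles_deg_gt0 : exists T, forall t i, T <= t ->
  (0 < hol t i) = (0 < hol T i) /\
  [exists j, 0 < hol T j] = (\sum_j u j < \sum_j h j).
Proof.
have ex T : [exists j, 0 < hol T j] = (0 < \sum_j hol T j).
  by rewrite lt0n sum_nat_eq0 negb_forall; apply: eq_existsb => j; rewrite lt0n.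
(* Either no token moves at some time, and all is frozen from then on, or tokens move forever and
   fill all holes; [balance] then compares the totals. *)
have [[T CT]|nC] := classic (exists T, \sum_i c T i = 0).
  have CC t : T <= t -> \sum_i c t i = 0 /\ forall i, hol t i = hol T i.
    move/subnK <-; elim: (t - T) => // m [C1 H1]; rewrite addSn.
    have I0 i : inflow (m + T) i = 0.
      apply/eqP; have := inflow_total (m + T); rewrite C1 => /eqP.
      by rewrite sum_nat_eq0 => /forallP/(_ i).
    by split=> [|i]; rewrite ?big1 // => *; rewrite ?cS ?holS I0 ?subn0.
  exists T => t i /CC[_ ->]; split=> //; rewrite ex.
  by have := balance T; rewrite CT; lia.
have [|i Ui] := some_unbounded.
  by move=> t; rewrite lt0n; apply/eqP => Ct; apply: nC; exists t.
have [T HT] := holes_filled Ui; exists T => t j Tt; rewrite !HT //; split=> //.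
by rewrite ex big1 => [|k _]; rewrite ?HT //; have := balance T;
  rewrite [X in _ = X + _]big1 => [|k _]; rewrite ?HT //; lia.
Qed.
End PositiveDegrees.

Lemma rotor_router_settles : exists T, forall t i, T <= t ->
  (0 < hol t i) = (0 < hol T i) /\
  [exists j, 0 < hol T j] = (\sum_j u j < \sum_j h j).
Proof.
have [/forallP|] := boolP [forall i, 0 < deg e i]; first exact: settles_deg_gt0.
(* By connectivity, a node without neighbors is the only one, and its holes stay as at time 0. *)
rewrite negb_forall => /existsP[j]; rewrite -eqn0Ngt => /eqP/card0_eq noe.
have all_j i : i = j.
  by have /connectP[[|k p] //=] := e_conn j i; have := noe k; rewrite inE => ->.
have hc t i : hol t i = hol 0 i.
  elim: t => // t <-; rewrite holS inflowE big1 ?subn0 // => k.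
  by rewrite (all_j i); have := noe k; rewrite inE => ->.
have one F : \sum_i F i = F j.
  by rewrite (bigD1 j) //= big1 ?addn0 // => i; rewrite (all_j i) eqxx.
exists 0 => t i _; rewrite hc; split=> //; rewrite !one.
apply/existsP/idP => [[k]|]; first by rewrite (all_j k) hol0; lia.
by exists j; rewrite hol0; lia.
Qed.
End RotorRouter.

(** * Detecting roots by growing and collapsing trees *)

Section Forest.
Variables (n : nat) (e : rel 'I_n).
Variables (src : nat -> 'I_n -> bool) (st : nat -> 'I_n -> option bool).
Variable (par : nat -> 'I_n -> option 'I_n).
Hypothesis e_sym : symmetric e.
Hypothesis e_conn : forall i j, connect e i j.
Hypothesis st0 : forall i, st 0 i = None.
Hypothesis link_root : forall t i, src t.+1 i ->
  st t.+1 i = Some true /\ par t.+1 i = None.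
Hypothesis link_attach : forall t i, ~~ src t.+1 i -> st t i = None ->
  (exists j, [/\ st t j = Some true, st t.+1 i = Some false & par t.+1 i = Some j])
  \/ ((forall j, e i j -> st t j <> Some true) /\ st t.+1 i = None).
Hypothesis link_keep : forall t i, ~~ src t.+1 i -> st t i ->
  (exists j, [/\ par t i = Some j, st t j, st t.+1 i = Some true
              & par t.+1 i = Some j])
  \/ (st t.+1 i = None /\ forall j, par t i = Some j -> st t j = None).

(* The time at which the current link was made, [0] for roots (junk for unlinked nodes). *)
Fixpoint since (t : nat) (i : 'I_n) : nat :=
  if t is s.+1 then
    if src t i then 0 else if st s i then since s i else t
  else 0.

Lemma since_le t i : since t i <= t.
Proof. by elim: t => //= t IH; case: ifP => // _; case: ifP; lia. Qed.

Lemma since_mature t i : st t i = Some true -> since t i < t.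
Proof.
case: t => [|t] /=; first by rewrite st0.
case: ifPn => // ns mat; case: ifPn => [|/negPf nst]; first by rewrite ltnS since_le.
have /(link_attach ns) : st t i = None by case: (st t i) nst.
by case=> [[j []]|[]]; rewrite mat.
Qed.

(** A new link goes to a mature parent, whose own link is thus older by at least 2; later the parent
    keeps its [since] or, as a root, resets it to 0. *)
Lemma since_parent t i j : st t.+1 i -> par t.+1 i = Some j ->
  st t j /\ since t j + 2 <= since t.+1 i.
Proof.
elim: t i => [|t IH] i sti pari.
- have [s|ns] := boolP (src 1 i); first by have [_] := link_root s; rewrite pari.
  have [[k [+ _ _]]|[_]] := link_attach ns (st0 i); first by rewrite st0.
  by move: sti => /[swap] ->.
- have [s|ns] := boolP (src t.+2 i); first by have [_] := link_root s; rewrite pari.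
  rewrite [since t.+2 i]/= (negPf ns); case: ifPn => [a|/negPf na].
    have [[k [park stk _]]|[]] := link_keep ns a; last by move: sti => /[swap] ->.
    rewrite pari => -[ejk]; rewrite -ejk in park stk; split=> //.
    have [stj le] := IH _ a park.
    rewrite [since t.+1 j]/= stj; case: ifP => _ //; move: le => /=; lia.
  have /(link_attach ns) : st t.+1 i = None by case: (st t.+1 i) na.
  case=> [[k [stk _]]|[_]]; last by move: sti => /[swap] ->.
  rewrite pari => -[->]; split; first by rewrite stk.
  by have := since_mature stk; lia.
Qed.

Lemma nonroot_parent t i : ~~ src t i -> st t i -> exists j, par t i = Some j.
Proof.
case: t => [|t]; rewrite ?st0 // => ns sti.
case E: (st t i) => [b|].
  have [|[j [? ? ? ->]]|[]] := link_keep (i := i) ns; rewrite ?E //; first by exists j.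
  by move: sti => /[swap] ->.
by have [[j [? ? ->]]|[_]] := link_attach ns E; [exists j|move: sti => /[swap] ->].
Qed.

Section Static.
Variable T : nat.
Hypothesis src_static : forall t i, T <= t -> src t i = src T i.

(* A node losing its link at time [t] has a parent that lost its own at [t - 1] and had
   been linked at least two steps earlier; the descent can only end before time [T]. *)
Lemma unlink_early t i :
  st t i -> st t.+1 i = None \/ (forall j, ~~ src T j) -> 2 * t < 2 * T + since t i.
Proof.
elim: t i => [|t IH] i sti bad; first by rewrite st0 in sti.
have [tT|Tt] := ltnP t.+1 T; first by lia.
have ns : ~~ src t.+1 i.
  rewrite src_static //; case: bad => // unl; apply/negP => s.
  by have [] := @link_root t.+1 i; rewrite ?src_static ?unl // leqW.
have [j parj] := nonroot_parent ns sti.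
have [stj le] := since_parent sti parj.
(* Passing to the parent goes back one step in time and lowers [since] by at least 2, so the bound
   for [j] gives that for [i]. *)
suff /(IH j stj) : st t.+1 j = None \/ (forall k, ~~ src T k) by lia.
case: bad => [unl|]; [left|by right].
have [|[k [_ _]]|[_]] := @link_keep t.+1 i _ sti; last exact.
  by rewrite (src_static _ (leqW Tt)) -(src_static i Tt).
by rewrite unl.
Qed.

Lemma linked_persists t i s : 2 * T <= t -> t <= s -> st t i -> st s i.
Proof.
move=> Tt /subnK <-; elim: (s - t) => // m IH /IH sti; rewrite addSn.
case E: (st (m + t).+1 i) => //.
(* As [since] is at most the current time, a link can only be lost before [2 * T]. *)
by have := unlink_early sti (or_introl E); have := since_le (m + t) i; lia.
Qed.

(** One step lets the link of [j] mature, the next lets [i] attach. *)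
Lemma linked_neighbor t i j : 2 * T <= t -> e i j -> st t j -> st t.+2 i.
Proof.
move=> Tt eij stj.
have mat : st t.+1 j = Some true.
  have [/link_root[]//|ns] := boolP (src t.+1 j).
  have [[k []]//|[E _]] := link_keep ns stj.
  by have := linked_persists Tt (leqnSn t) stj; rewrite E.
case E: (st t.+1 i) => [b|].
  by apply: linked_persists (leqnSn _) _; [lia|rewrite E].
have [/link_root[->]//|ns] := boolP (src t.+2 i).
by have [[k [_ -> _]]//|[/(_ j eij)]] := link_attach ns E.
Qed.

Lemma forest_detects : exists T', forall t i, T' <= t ->
  (st t i : bool) = [exists j, src T j].
Proof.
have [/existsP[r sr]|] := boolP [exists j, src T j]; last first.
  rewrite negb_exists => /forallP ns; exists (2 * T) => t i Tt.
  apply/negP => sti; have := unlink_early sti (or_intror ns).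
  by have := since_le t i; lia.
have /fin_all_exists[T' HT'] : forall i, exists T', forall t, T' <= t -> st t i.
  move=> i; suff [t Tt sti] : exists2 t, 2 * T <= t & st t i.
    by exists t => s ts; apply: linked_persists sti.
  have /connectP[p + ->] := e_conn r i.
  have : exists2 t, 2 * T <= t & st t r.
    have /link_root[str _] : src (2 * T).+1 r by rewrite src_static //; lia.
    by exists (2 * T).+1; rewrite ?leqnSn ?str.
  elim: p r {sr} => //= k p IH r [t Tt str] /andP[erk pk].
  apply: IH pk; exists t.+2; first by rewrite !leqW.
  by apply: linked_neighbor str; rewrite // e_sym.
exists (\max_i T' i) => t i it; rewrite HT' //.
by apply: leq_trans it; apply: leq_bigmax.
Qed.
End Static.
End Forest.

(** * The automaton and its memory bound *)

Section Automaton.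
Variable K : nat.

(* Instance [(true, k)] decides whether the average is below [k] ([k] holes per node, one
   token per unit of input); [(false, k)] swaps holes and tokens to decide whether it is
   above [k]. *)
Definition instance : finType := (bool * 'I_K.+1)%type.
Definition holes (q : instance) (x : 'I_K.+1) : nat := if q.1 then q.2 else x.
Definition tokens (q : instance) (x : 'I_K.+1) : nat := if q.1 then x else q.2.

(* Unfilled holes, rotor position, and forest link: [None] is unlinked, [Some false] freshly
   linked, [Some true] available as a parent; the second component is the parent's port. *)
Definition cell (d : nat) : finType :=
  ('I_K.+1 * 'I_d.+1 * (option bool * option 'I_d))%type.
Definition memory (d : nat) : finType := {ffun instance -> cell d}.
Definition message : finType := {ffun instance -> 'I_K.+1 * option bool}.

Definition memory0 (d : nat) : memory d := [ffun=> (ord0, ord0, (None, None))].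
Definition message0 : message := [ffun=> (ord0, None)].

(** A link without a parent port is that of a root; a node that ceases to be a root starts over
    unlinked. *)
Definition relink (d : nat) (is_root : bool) (l : option bool * option 'I_d)
    (heard : 'I_d -> option bool) : option bool * option 'I_d :=
  if is_root then (Some true, None) else
  match l with
  | (None, _) =>
      if [pick k | heard k == Some true] is Some k then (Some false, Some k)
      else (None, None)
  | (Some _, Some k) => if heard k then (Some true, Some k) else (None, None)
  | (Some _, None) => (None, None)
  end.

Lemma eq_relink d is_root (l : option bool * option 'I_d) f g :
  f =1 g -> relink is_root l f = relink is_root l g.
Proof.
move=> fg; rewrite /relink; case: l => [[a|] [k|]] //=; rewrite ?fg //.
all: by rewrite (eq_pick (Q := fun k => g k == Some true)) // => r; rewrite fg.
Qed.

Section Step.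
Variables (d : nat) (q : instance) (x : 'I_K.+1) (fresh : bool) (z : cell d).
Variable mu : {ffun 'I_d -> message}.

(** The initial memory cannot depend on the input, so the first step, recognized by the still empty
    output, loads tokens and holes from [x]. *)
Definition arrivals : nat := if fresh then tokens q x else \sum_(k < d) (mu k q).1.
Definition vacancies : nat := if fresh then holes q x else z.1.1.
Definition surplus : nat := arrivals - vacancies.
Definition new_link := relink (0 < vacancies - arrivals) z.2 (fun k => (mu k q).2).
Definition new_cell : cell d :=
  (inord (vacancies - arrivals), inord ((z.1.2 + surplus) %% d), new_link).
Definition outgoing (p : 'I_d) : 'I_K.+1 * option bool :=
  (inord (share d z.1.2 surplus p), new_link.1).
End Step.

Definition verdict (d : nat) (z : memory d) : 'I_K.*2.+1 :=
  let linked b k : bool := (z (b, inord k)).2.1 in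
  odflt ord0 [pick y : 'I_K.*2.+1 |
    if odd y then linked false y./2 && linked true y./2.+1
    else ~~ linked false y./2 && ~~ linked true y./2].

Definition averager : automaton 'I_K.+1 'I_K.*2.+1 message memory :=
  fun d x z y mu =>
    let fresh := y == None in
    let z' := [ffun q => new_cell q x fresh (z q) mu] in
    (z', Some (verdict z'), [ffun p => [ffun q => outgoing q x fresh (z q) mu p]]).

Lemma averager_finite_memory : finite_memory memory.
Proof.
(* A cell has at most [2 ^ (K + 2 * d + 2)] values, and the number of instances does not depend on
   [d]. *)
exists ((K + 4) * #|instance|) => d d0; rewrite card_ffun mulnAC expnM leq_exp2r; last first.
  by rewrite card_prod card_bool card_ord.
rewrite !card_prod !card_option card_bool !card_ord.
have lt m : m.+1 <= 2 ^ m by apply: ltn_expl.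
apply: (@leq_trans (2 ^ K * 2 ^ d * (2 ^ 2 * 2 ^ d))).
  by do !apply: leq_mul.
by rewrite -!expnD leq_exp2l //; nia.
Qed.

(** * The execution realizes the rotor walk and the forest *)

Section Run.
Variables (n : nat) (e : rel 'I_n) (nbr : forall i : 'I_n, 'I_(deg e i) -> 'I_n).
Arguments nbr : clear implicits.
Hypothesis graph : simple_connected_graph e.
Hypothesis ports : port_labeling nbr.
Variable x : 'I_n -> 'I_K.+1.

Let e_sym : symmetric e. Proof. by case: graph => _ []. Qed.
Let e_conn : forall i j, connect e i j. Proof. by case: graph => _ []. Qed.

Definition port (j i : 'I_n) : nat :=
  if [pick p | nbr j p == i] is Some p then p : nat else 0.

Lemma port_nbr j p : port j (nbr j p) = p.
Proof.
rewrite /port; case: pickP => [r /eqP|/(_ p)]; last by rewrite eqxx.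
by have [inj _] := ports j => /inj ->.
Qed.

Lemma sum_neighbors j (F : 'I_n -> nat) : \sum_(i | e j i) F i = \sum_p F (nbr j p).
Proof.
have [inj [edge onto]] := ports j.
transitivity (\sum_(i in nbr j @: setT) F i).
  apply: eq_bigl => i; apply/idP/imsetP => [/onto[p <-]|[p _ ->] //].
  by exists p.
rewrite big_imset => [|p r _ _ /inj //] /=.
by apply: eq_bigl => p; rewrite inE.
Qed.

Lemma sum_ports j (F : nat -> nat) : \sum_(i | e j i) F (port j i) = \sum_(p < deg e j) F p.
Proof. by rewrite sum_neighbors; under eq_bigr do rewrite port_nbr. Qed.

(** Edges being symmetric, the sender has a port back to the receiver, so the default [m0] never
    intervenes. *)
Lemma receivedP Y (Z : nat -> finType) (m0 : message) (s : forall j, state Z Y message (deg e j))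
    i k : exists p : 'I_(deg e (nbr i k)),
  received m0 nbr s i k = (s (nbr i k)).2 p /\ port (nbr i k) i = p.
Proof.
rewrite ffunE /port; case: pickP => [p _|none]; first by exists p.
have [_ [/(_ k) edge _]] := ports i; rewrite e_sym in edge.
have [_ [_ /(_ _ edge)[p np]]] := ports (nbr i k).
by have := none p; rewrite np eqxx.
Qed.

Let s t i := exec memory0 message0 averager nbr x t i.
Let mu t i := received message0 nbr (s t) i.

Lemma fresh_exec t i : ((s t i).1.2 == None) = (t == 0).
Proof. by case: t. Qed.

Lemma output_exec t i : output memory0 message0 averager nbr x t.+1 i
  = Some (verdict (s t.+1 i).1.1).
Proof. by []. Qed.

Variable q : instance.
Let cel t i : cell (deg e i) := (s t i).1.1 q.

Lemma cell_exec t i : cel t.+1 i = new_cell q (x i) (t == 0) (cel t i) (mu t i).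
Proof. by rewrite /cel /= ffunE fresh_exec. Qed.

Lemma message_exec t i p :
  (s t.+1 i).2 p q = outgoing q (x i) (t == 0) (cel t i) (mu t i) p.
Proof. by rewrite /= !ffunE fresh_exec. Qed.

(** Time 0 of the walk is the state just after the first step has loaded the input, hence the
    shift. *)
Let hol t i : nat := (cel t.+1 i).1.1.
Let inflow t i : nat := \sum_k (mu t.+1 i k q).1.
Let c t i : nat := surplus q (x i) (t == 0) (cel t i) (mu t i).
Let R t i : nat := \sum_(r < t) c r i.

Lemma instance_le a : holes q a <= K /\ tokens q a <= K.
Proof. by rewrite /holes /tokens; case: q.1; rewrite !leq_ord. Qed.

Lemma hol_exec t i : hol t i = vacancies q (x i) (t == 0) (cel t i)
  - arrivals q (x i) (t == 0) (mu t i).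
Proof.
rewrite /hol cell_exec /= inordK // ltnS; apply: leq_trans (leq_subr _ _) _.
rewrite /vacancies; case: ifP => _; first by have [] := instance_le (x i).
exact: leq_ord.
Qed.

(** At most [K] tokens arrive per port, so by [share_le] at most [K] leave per port, and [inord]
    never truncates a message. *)
Lemma c_le t i : 0 < deg e i -> c t i <= deg e i * K.
Proof.
move=> d0; apply: leq_trans (leq_subr _ _) _.
rewrite /arrivals; case: ifP => _.
  by have [_ le] := instance_le (x i); apply: leq_trans le _; rewrite leq_pmull.
rewrite -[deg e i in leqRHS]card_ord -sum_nat_const; apply: leq_sum => k _.
exact: leq_ord.
Qed.

Lemma rotor_exec t i : 0 < deg e i -> (cel t i).1.2 = R t i %% deg e i :> nat.
Proof.
move=> d0; elim: t => [|t IH]; first by rewrite /R big_ord0 mod0n /cel /= ffunE.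
rewrite cell_exec /= inordK ?IH; last by rewrite ltnS ltnW // ltn_mod.
by rewrite modnDml /R (sum_ltnS (c^~ i)).
Qed.

Lemma inflow_exec t i : inflow t i =
  \sum_(j | e i j) share (deg e j) (R t j) (c t j) (port j i).
Proof.
rewrite sum_neighbors; apply: eq_bigr => k _; rewrite /mu.
have [p [-> ->]] := receivedP message0 (s t.+1) k.
have d0 : 0 < deg e (nbr i k) by case: (deg e _) p => [[]|].
rewrite message_exec /= inordK ?rotor_exec ?share_mod // ltnS.
by apply: share_le => //; apply: c_le.
Qed.

Lemma holes_settle : exists T, forall t i, T <= t ->
  (0 < hol t i) = (0 < hol T i) /\
  [exists j, 0 < hol T j] =
    (\sum_j tokens q (x j) < \sum_j holes q (x j)).
Proof.
apply: (@rotor_router_settles n e port _ _ hol c R inflow) => //.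
- exact: sum_ports.
- by move=> i; rewrite hol_exec.
- by move=> t i; rewrite hol_exec.
- by move=> i; rewrite /R big_ord0.
- by move=> t i; rewrite /R (sum_ltnS (c^~ i)).
- exact: inflow_exec.
Qed.

Let src t i : bool := 0 < (cel t i).1.1.
Let st t i : option bool := (cel t i).2.1.
Let par t i : option 'I_n := omap (nbr i) (cel t i).2.2.

Lemma heard_exec t i k : (mu t i k q).2 = st t (nbr i k).
Proof.
rewrite /mu; have [p [-> _]] := receivedP message0 (s t) k.
case: t => [|t]; first by rewrite /st /cel /= !ffunE.
by rewrite message_exec /st cell_exec.
Qed.

Lemma link_exec t i : (cel t.+1 i).2 =
  relink (src t.+1 i) (cel t i).2 (fun k => st t (nbr i k)).
Proof.
have -> : src t.+1 i = (0 < hol t i) by [].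
rewrite hol_exec cell_exec /= /new_link; by apply: eq_relink => k; rewrite heard_exec.
Qed.

Lemma links_detect : exists T, forall t i, T <= t ->
  (st t i : bool) = (\sum_j tokens q (x j) < \sum_j holes q (x j)).
Proof.
have [T HT] := holes_settle.
(* [src] follows [hol] with a delay of one step, hence [T.+1]. *)
have [|||||T' HT'] := @forest_detects n e src st par e_sym e_conn _ _ _ _ T.+1.
- by move=> i; rewrite /st /cel /= ffunE.
- by move=> t i r; rewrite /st /par link_exec /relink r.
- move=> t i /negPf nr; rewrite /st /par !link_exec /relink nr => unl.
  case: ((cel t i).2) unl => [_ b] /= ->; case: pickP => [k /eqP sk|none].
    by left; exists (nbr i k).
  right; split=> // j eij; have [_ [_ /(_ j eij)[k <-]]] := ports i.
  by move=> sk; have := none k; rewrite /st sk eqxx.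
- move=> t i /negPf nr; rewrite /st /par !link_exec /relink nr.
  case: ((cel t i).2) => [[a|] [k|]] //= _; last by right.
  case E: (st t (nbr i k)) => /=.
    by left; exists (nbr i k); rewrite -/(st t (nbr i k)) E.
  by right; split=> // j [<-]; apply: E.
- move=> [|t] i // Tt; exact: (HT t i Tt).1.
exists T' => t i /HT' ->.
exact: (HT T i (leqnn T)).2.
Qed.
End Run.


(** * Reading off the average *)

Lemma lt_average n (x : 'I_n -> 'I_K.+1) (k : nat) : 0 < n ->
  (k%:R < average x)%R = (k * n < \sum_i x i).
Proof.
move=> n0; rewrite /average -natr_sum ltr_pdivlMr ?ltr0n //.
by rewrite -natrM ltr_nat.
Qed.

Lemma average_lt n (x : 'I_n -> 'I_K.+1) (k : nat) : 0 < n ->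
  (average x < k%:R)%R = (\sum_i x i < k * n).
Proof.
move=> n0; rewrite /average -natr_sum ltr_pdivrMr ?ltr0n //.
by rewrite -natrM ltr_nat.
Qed.

Lemma inY_average n (x : 'I_n -> 'I_K.+1) (y : 'I_K.*2.+1) : 0 < n ->
  inY y (average x) =
    if odd y then (y./2 * n < \sum_i x i) && (\sum_i x i < y./2.+1 * n)
    else ~~ (y./2 * n < \sum_i x i) && ~~ (\sum_i x i < y./2 * n).
Proof.
move=> n0; rewrite /inY; case: odd; rewrite -?lt_average -?average_lt //.
by rewrite -!leNgt eq_le.
Qed.

Lemma averager_computes n (e : rel 'I_n) (nbr : forall i : 'I_n, 'I_(deg e i) -> 'I_n) x :
  0 < n -> simple_connected_graph e -> port_labeling nbr ->
  exists T, forall t, T <= t -> forall i,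
    output memory0 message0 averager nbr x t i = Some (f_avg x).
Proof.
move=> n0 graph ports.
have /fin_all_exists[T HT] := links_detect graph ports x.
(* All instances have settled by the maximum; the successor excludes time 0, when outputs are
   empty. *)
exists (\max_q T q).+1 => -[//|t] /ltnSE Tt i; rewrite output_exec; congr Some.
set z := (exec _ _ _ _ _ _ i).1.1.
have zE q : ((z q).2.1 : bool) = (\sum_j tokens q (x j) < \sum_j holes q (x j)).
  by apply: HT; apply: leqW (leq_trans _ Tt); apply: leq_bigmax.
rewrite /verdict /f_avg; congr odflt; apply: eq_pick => y /=.
have low k : k <= K -> (isSome (z (false, inord k)).2.1 = (k * n < \sum_i x i))
   /\ (isSome (z (true, inord k)).2.1 = (\sum_i x i < k * n)).
  by move=> kK; rewrite !zE /holes /tokens /= sum_nat_const card_ord inordK // mulnC.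
(* An odd index is at most [2 * K - 1], so every threshold used is at most [K] and [inord] is
   faithful. *)
have [yK oyK] : y./2 <= K /\ (odd y -> y./2.+1 <= K) by have := ltn_ord y; lia.
have [E1 E2] := low _ yK; rewrite inY_average // E1.
by case: ifP => [/oyK/low[_ ->]|]; rewrite ?E2.
Qed.
End Automaton.

Theorem theorem2 (K : nat) : computable (@f_avg K).
Proof.
exists (message K), (memory K), (@memory0 K), (message0 K), (@averager K).
split; first exact: averager_finite_memory.
by move=> n n0 e nbr graph ports x; apply: averager_computes.
Qed.
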